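(* (1) There exists a tree with exactly three distinct $Q$-main eigenvalues, one of which is zero, that is isomorphic to none of the following trees: the trees obtained from a path on five vertices by attaching the same number of additional leaves to each of the two vertices adjacent to its endvertices; and the tree obtained from a path on seven vertices by attaching one additional leaf to each of the two vertices adjacent to its endvertices. (2) There exists a unicyclic graph with exactly three distinct $Q$-main eigenvalues, one of which is zero, that is not isomorphic to any graph obtained from an even cycle by attaching the same positive number of leaves to alternate cycle vertices (that is, to each vertex of one of the two bipartition classes of the cycle). (3) There exists a bicyclic graph with exactly three distinct $Q$-main eigenvalues, one of which is zero, that is isomorphic to none of the following three graphs: two $4$-cycles sharing exactly one vertex; two disjoint $4$-cycles joined by a path of length $4$ (with one endpoint on each cycle and no other vertices in common with the cycles); and the graph formed by three internally disjoint paths of length $4$ with common endpoints.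
   Context: All graphs are finite, simple, connected, undirected, and have at least one edge. For a graph $G$, $A(G)$ is the adjacency matrix, $D(G)$ the diagonal matrix of vertex degrees, and $Q(G)=A(G)+D(G)$ is the signless Laplacian. An eigenvalue $\lambda$ of $Q(G)$ is $Q$-main if its eigenspace is not orthogonal to the all-ones vector $\mathbf{1}$. The cyclomatic number of $G$ is $|E(G)|-|V(G)|+1$; trees, unicyclic graphs, and bicyclic graphs are the connected graphs with cyclomatic number $0$, $1$, and $2$ respectively. Attaching a leaf to a vertex $v$ means adding a new vertex adjacent only to $v$. *)

(* Defs.v *)
From HB Require Import structures.
From mathcomp Require Import all_boot all_order all_algebra.
From mathcomp Require Import reals.

Set Implicit Arguments.
Unset Strict Implicit.
Unset Printing Implicit Defensive.

Import GRing.Theory Num.Theory.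
Local Open Scope ring_scope.

(* Finite simple undirected graphs; connectedness and the existence of an
   edge are required separately, by [conn_graph]. *)
Record sgraph := SGraph {
  vertex :> finType;
  adj : rel vertex;
  adj_sym : symmetric adj;
  adj_irr : irreflexive adj }.
Arguments SGraph : clear implicits.

Definition conn_graph (G : sgraph) : Prop :=
  (forall x y : G, connect (@adj G) x y) /\ (exists x y : G, adj x y).

Definition isomorphic (G H : sgraph) : Prop :=
  exists2 f : G -> H, bijective f & forall x y : G, adj (f x) (f y) = adj x y.

Definition edges (G : sgraph) : {set {set G}} :=
  [set E : {set G} | [exists x, exists y, adj x y && (E == [set x; y])]].

Definition cyclomatic (G : sgraph) : int :=
  #|edges G|%:Z - #|G|%:Z + 1.

Definition tree (G : sgraph) : Prop := conn_graph G /\ cyclomatic G = 0.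
Definition unicyclic (G : sgraph) : Prop := conn_graph G /\ cyclomatic G = 1.
Definition bicyclic (G : sgraph) : Prop := conn_graph G /\ cyclomatic G = 2.

Definition degree (G : sgraph) (x : G) : nat := #|[set y | adj x y]|.

(* Rows and columns are indexed by the vertices through [enum_val]. *)
Definition adj_mx (R : realType) (G : sgraph) : 'M[R]_#|G| :=
  \matrix_(i, j) (adj (enum_val i) (enum_val j))%:R.

Definition deg_mx (R : realType) (G : sgraph) : 'M[R]_#|G| :=
  diag_mx (\row_i (degree (enum_val i))%:R).

Definition signless_laplacian (R : realType) (G : sgraph) : 'M[R]_#|G| :=
  adj_mx R G + deg_mx R G.

(* MathComp eigenvectors are row vectors, which is harmless here because the
   matrix is symmetric. *)
Definition Qmain (R : realType) (G : sgraph) (a : R) : Prop :=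
  eigenvalue (signless_laplacian R G) a /\
  exists2 v : 'rV[R]_#|G|,
    (v <= eigenspace (signless_laplacian R G) a)%MS &
    v *m (const_mx 1 : 'cV[R]_#|G|) != 0.

Definition three_Qmain_with_zero (R : realType) (G : sgraph) : Prop :=
  exists s : seq R,
    [/\ uniq s, size s = 3%N, 0 \in s & forall a : R, a \in s <-> Qmain G a].

Local Open Scope nat_scope.

(* The graph on {0, ..., n-1} whose edges are the pairs of consecutive entries
   of the sequences in [ws]. *)
Definition walks_adj (n : nat) (ws : seq (seq nat)) : rel 'I_n :=
  fun i j => (i != j) &&
    has (fun w => let s := zip w (behead w) in
                  ((val i, val j) \in s) || ((val j, val i) \in s)) ws.

Lemma walks_adj_sym n ws : symmetric (@walks_adj n ws).
Proof.
move=> i j; rewrite /walks_adj eq_sym; congr (_ && _).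
by apply: eq_has => w /=; rewrite orbC.
Qed.

Lemma walks_adj_irr n ws : irreflexive (@walks_adj n ws).
Proof. by move=> i; rewrite /walks_adj eqxx. Qed.

Definition walks_graph (n : nat) (ws : seq (seq nat)) : sgraph :=
  SGraph 'I_n (@walks_adj n ws) (@walks_adj_sym n ws) (@walks_adj_irr n ws).

Definition path_graph (n : nat) : sgraph := walks_graph n [:: iota 0 n].

(* A cycle for n >= 3 only. *)
Definition cycle_graph (n : nat) : sgraph :=
  walks_graph n [:: rcons (iota 0 n) 0].

(* [attach_leaves G m] attaches [m x] new leaves to each vertex [x] of [G];
   the leaves at [x] are the [Tagged _ i] with [i : 'I_(m x)]. *)
Definition leaf (G : sgraph) (m : G -> nat) : finType := {x : G & 'I_(m x)}.

Definition attach_adj (G : sgraph) (m : G -> nat) : rel (G + leaf m)%type :=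
  fun u v => match u, v with
  | inl x, inl y => adj x y
  | inl x, inr l => x == tag l
  | inr l, inl y => y == tag l
  | inr _, inr _ => false
  end.

Lemma attach_adj_sym (G : sgraph) (m : G -> nat) : symmetric (@attach_adj G m).
Proof. by move=> [x|l] [y|k] //=; apply: adj_sym. Qed.

Lemma attach_adj_irr (G : sgraph) (m : G -> nat) :
  irreflexive (@attach_adj G m).
Proof. by move=> [x|l] //=; apply: adj_irr. Qed.

Definition attach_leaves (G : sgraph) (m : G -> nat) : sgraph :=
  SGraph (G + leaf m)%type (@attach_adj G m)
    (@attach_adj_sym G m) (@attach_adj_irr G m).

(* In the path 0 - 1 - ... - (n-1), the neighbours of the endvertices are
   1 and n-2. *)
Definition path_leaves (n k : nat) : sgraph :=
  @attach_leaves (path_graph n)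
    (fun x : 'I_n => if (val x == 1) || (val x == n - 2) then k else 0).

(* For an even cycle, the parity of the index gives the bipartition; [b]
   selects one of its two classes. *)
Definition cycle_leaves (n k : nat) (b : bool) : sgraph :=
  @attach_leaves (cycle_graph n)
    (fun x : 'I_n => if odd (val x) == b then k else 0).

Definition two_C4_sharing_vertex : sgraph :=
  walks_graph 7 [:: [:: 0; 1; 2; 3; 0]; [:: 0; 4; 5; 6; 0]].

(* The length of a path is its number of edges. *)
Definition two_C4_joined_by_path4 : sgraph :=
  walks_graph 11 [:: [:: 0; 1; 2; 3; 0]; [:: 0; 4; 5; 6; 7];
                     [:: 7; 8; 9; 10; 7]].

Definition three_paths4 : sgraph :=
  walks_graph 11 [:: [:: 0; 2; 3; 4; 1]; [:: 0; 5; 6; 7; 1];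
                     [:: 0; 8; 9; 10; 1]].

(* Main.v *)
Require Import Defs.
From mathcomp Require Import all_boot all_order all_algebra.
From mathcomp Require Import reals.
From mathcomp Require Import zify ring.

Set Implicit Arguments.
Unset Strict Implicit.
Unset Printing Implicit Defensive.

Import Order.TTheory GRing.Theory Num.Theory.

(** Let [d] be the degree function of a bipartite graph [G] with classes
    distinguished by [side], and suppose that there are numbers [p] and
    [c true], [c false] such that every vertex [x] satisfies
      sum of [d y] over the neighbours [y] of [x] = p d(x) - d(x)^2 - c(side x).
    Write Q for the signless Laplacian and [q = c true + c false].  Then
      Q 1 = 2 d,   Q d = p d - c,   Q c = q d,
    so the span of 1, [d] and [c] is stable under Q and 1 is killed by
    Q (Q^2 - p Q + q).  As Q is symmetric, a Q-main eigenvalue is a root of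
    X (X^2 - p X + q).  Conversely the root 0 is main as soon as the two classes
    have different sizes, because the signs of the bipartition are an eigenvector
    for 0; and a root r of the quadratic factor has the eigenvector r d - c,
    whose entries do not add up to 0 under a numerical condition.  This is
    [three_Qmain_criterion].

    The local condition involves only degrees, which makes it easy to assemble
    graphs that satisfy it.  The three examples are
    - the claw with two leaves attached to each end, a tree on 10 vertices with
      Q-main eigenvalues 0, 2, 5;
    - the 4-cycle with two opposite vertices each joined to the centre of its own
      claw, a unicyclic graph with Q-main eigenvalues 0 and 3 +- sqrt 6;
    - K_{2,3} with one leaf attached to each vertex of the larger class, a
      bicyclic graph on 8 vertices with Q-main eigenvalues 0 and
      (7 +- sqrt 17) / 2.
    The first and the last are told apart from the listed graphs by their numbers
    of vertices.  The second has adjacent vertices of degrees 3 and 4, whereas in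
    an even cycle with leaves at alternate vertices every edge has an end of
    degree at most 2 ([cycle_leaves_degree]). *)

(** * The signless Laplacian acting on functions *)

Section Laplacian.
Variables (R : realType) (G : sgraph).
Local Open Scope ring_scope.

(** The signless Laplacian on functions on the vertices, which avoids the
    numbering of the vertices that matrices need. *)
Definition lapl (f : G -> R) (x : G) : R :=
  (degree x)%:R * f x + \sum_(y | adj x y) f y.

(** Both sides are the sum of a diagonal term and of [f x * g y] over all
    ordered pairs of adjacent vertices. *)
Lemma lapl_selfadjoint (f g : G -> R) :
  \sum_x f x * lapl g x = \sum_x lapl f x * g x.
Proof.
have split_sum h1 h2 : \sum_x h1 x * lapl h2 x =
    \sum_x (degree x)%:R * h1 x * h2 x + \sum_x \sum_(y | adj x y) h1 x * h2 y.
  rewrite -big_split; apply: eq_bigr => x _ /=.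
  by rewrite mulrDr mulrCA mulrA mulr_sumr.
rewrite split_sum; under [RHS]eq_bigr do rewrite mulrC.
rewrite split_sum; congr (_ + _); first by apply: eq_bigr => x _; ring.
rewrite (exchange_big_dep xpredT) //=; apply: eq_bigr => x _.
by apply: eq_big => y; [rewrite adj_sym | rewrite mulrC].
Qed.

Definition row_of (f : G -> R) : 'rV[R]_#|G| := \row_i f (enum_val i).

Lemma row_of_inj f g : row_of f = row_of g -> f =1 g.
Proof. by move=> /rowP E x; have := E (enum_rank x); rewrite !mxE enum_rankK. Qed.

Lemma row_of_surj (v : 'rV[R]_#|G|) : v = row_of (fun x => v ord0 (enum_rank x)).
Proof. by apply/rowP => i; rewrite mxE enum_valK. Qed.

Lemma sum_enum_val (F : G -> R) : \sum_(i < #|G|) F (enum_val i) = \sum_x F x.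
Proof.
rewrite [RHS](reindex (@enum_val G predT)) //.
by apply: onW_bij; apply: enum_val_bij.
Qed.

Lemma row_of_mul (f : G -> R) :
  row_of f *m signless_laplacian R G = row_of (lapl f).
Proof.
apply/rowP => j; rewrite mulmxDr mxE [X in X + _]mxE mul_mx_diag !mxE.
rewrite addrC; congr (_ + _); first by rewrite mulrC.
under eq_bigr do rewrite !mxE.
rewrite (sum_enum_val (fun x => f x * (adj x (enum_val j))%:R)).
rewrite [RHS]big_mkcond; apply: eq_bigr => x _.
by rewrite adj_sym; case: adj; rewrite ?mulr1 ?mulr0.
Qed.

Lemma QmainP (a : R) :
  Qmain G a <->
  exists2 f : G -> R, lapl f =1 (fun x => a * f x) & \sum_x f x != 0.
Proof.
have row_sum f : row_of f *m (const_mx 1 : 'cV[R]_#|G|) = (\sum_x f x)%:M.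
  apply/matrixP => i j; rewrite !ord1 !mxE mulr1n -sum_enum_val.
  by apply: eq_bigr => k _; rewrite !mxE mulr1.
have row_scale f : a *: row_of f = row_of (fun x => a * f x).
  by apply/rowP => i; rewrite !mxE.
split=> [[_ [v v_eig v_main]] | [f f_eig f_main]].
  rewrite (row_of_surj v) in v_eig v_main.
  set f := (fun x : G => _) in v_eig v_main.
  exists f.
    by apply: row_of_inj; rewrite -row_scale -row_of_mul; apply/eigenspaceP.
  by apply: contraNneq v_main => f0; rewrite row_sum f0 raddf0.
have f_row : (row_of f <= eigenspace (signless_laplacian R G) a)%MS.
  apply/eigenspaceP; rewrite row_of_mul row_scale.
  by apply/rowP => i; rewrite !mxE f_eig.
have f_main' : row_of f *m (const_mx 1 : 'cV[R]_#|G|) != 0.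
  rewrite row_sum; apply: contraNneq f_main => f0.
  by have := congr1 (fun M : 'M_1 => M ord0 ord0) f0; rewrite !mxE mulr1n => ->.
split; last by exists (row_of f).
apply/eigenvalueP; exists (row_of f); first exact/eigenspaceP.
by apply: contraNneq f_main' => ->; rewrite mul0mx.
Qed.

End Laplacian.

(** * Bipartite graphs with a quadratic local degree condition *)

(** [C] is the inner product of [c] with 1, and [N] that of [d] with 1.  The
    eigenvector r d - c has sum r N - C, and since the two roots r have sum [p]
    and product [q], the product of the two sums is C^2 - p C N + q N^2.  The
    inequality [4 * q < p ^ 2] makes the two roots real and distinct, and
    [0 < q] makes them nonzero. *)
Lemma three_Qmain_criterion (R : realType) (G : sgraph) (side : G -> bool)
    (p : nat) (c : bool -> nat) (q := c true + c false)
    (N := \sum_(x : G) degree x) (C := \sum_(x : G) c (side x)) :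
  (forall x y : G, adj x y -> side y = ~~ side x) ->
  (\sum_(x : G) side x).*2 != #|G| ->
  (forall x : G,
     \sum_(y | adj x y) degree y + degree x ^ 2 + c (side x) = p * degree x) ->
  0 < q -> 4 * q < p ^ 2 -> C ^ 2 + q * N ^ 2 != p * C * N ->
  three_Qmain_with_zero R G.
Proof.
move=> bip unbal loc q_gt0 disc_gt0 nondeg.
pose d (x : G) : R := ((degree x)%:R)%R.
pose e (x : G) : R := ((c (side x))%:R)%R.
have lapl1 : lapl (fun=> 1%R) =1 (fun x => 2 * d x)%R.
  move=> x; rewrite /lapl sumr_const mulr1 -cardsE -/(degree x).
  by rewrite -/(d x); ring.
have lapld : lapl d =1 (fun x => p%:R * d x - e x)%R.
  by move=> x; rewrite /lapl /d /e -natr_sum -[in RHS]natrM -loc !natrD natrX; ring.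
have laple : lapl e =1 (fun x => q%:R * d x)%R.
  move=> x; rewrite /lapl.
  rewrite (eq_bigr (fun=> (c (~~ side x))%:R)%R); last first.
    by move=> y /bip; rewrite /e => ->.
  rewrite sumr_const -cardsE -/(degree x).
  rewrite -[X in (_ + X)%R]mulr_natl -mulrDr -natrD.
  rewrite mulrC /d /e /q; congr (_%:R * _)%R.
  by case: (side x); rewrite // addnC.
pose D := Num.sqrt (p%:R ^+ 2 - 4 * q%:R : R)%R.
have disc_gt0' : (0 < p%:R ^+ 2 - 4 * q%:R :> R)%R.
  by rewrite subr_gt0 -natrX -natrM ltr_nat.
have DD : (D ^+ 2 = p%:R ^+ 2 - 4 * q%:R)%R by rewrite sqr_sqrtr // ltW.
have D_gt0 : (0 < D)%R by rewrite sqrtr_gt0.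
pose r1 := ((p%:R + D) / 2)%R; pose r2 := ((p%:R - D) / 2)%R.
have Q_gt0 : (0 < q%:R :> R)%R by rewrite ltr0n.
have factor a : (a ^+ 2 - p%:R * a + q%:R = (a - r1) * (a - r2))%R.
  rewrite /r1 /r2.
  have -> : (q%:R = (p%:R ^+ 2 - D ^+ 2) / 4 :> R)%R by rewrite DD; field.
  by field.
exists [:: 0%R; r1; r2]; split=> //.
- rewrite /= !inE negb_or andbT -andbA.
  have r12 : (r1 * r2 = q%:R)%R.
    by have := factor 0%R; rewrite expr2 !mul0r mulr0 !sub0r mulrNN oppr0 !add0r => <-.
  have : (r1 * r2 != 0)%R by rewrite r12 gt_eqF.
  rewrite mulf_eq0 negb_or !(eq_sym 0%R) => /andP[-> ->] /=.
  rewrite -subr_eq0 /r1 /r2.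
  have -> : ((p%:R + D) / 2 - (p%:R - D) / 2 = D :> R)%R by field.
  by rewrite gt_eqF.
- by rewrite inE eqxx.
(* Pairing an eigenvector [f] with 1, [d] and [c] turns the three formulas for
   Q 1, Q d and Q c into linear relations between three numbers. *)
move=> a; split; last first.
  case/QmainP => f f_eig f_main.
  pose dot (g : G -> R) := (\sum_x f x * g x)%R.
  have dot_lapl g h : lapl g =1 h -> dot h = (a * dot g)%R.
    move=> gh; rewrite /dot -(eq_bigr _ (fun x _ => congr1 _ (gh x))).
    rewrite lapl_selfadjoint mulr_sumr; apply: eq_bigr => x _.
    by rewrite f_eig mulrA.
  have E1 := dot_lapl _ _ lapl1; have E2 := dot_lapl _ _ lapld.
  have E3 := dot_lapl _ _ laple.
  have dotZ k g : dot (fun x => k * g x)%R = (k * dot g)%R.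
    by rewrite /dot mulr_sumr; apply: eq_bigr => x _; ring.
  have dotB g h : dot (fun x => g x - h x)%R = (dot g - dot h)%R.
    by rewrite /dot -sumrB; apply: eq_bigr => x _; ring.
  rewrite dotZ in E1; rewrite dotB dotZ in E2; rewrite dotZ in E3.
  have one_neq0 : dot (fun=> 1)%R != 0%R.
    by rewrite /dot; under eq_bigr do rewrite mulr1.
  have : (a * (a ^+ 2 - p%:R * a + q%:R) * dot (fun=> 1) = 0)%R.
    have -> : (a * (a ^+ 2 - p%:R * a + q%:R) * dot (fun=> 1) =
            (a ^+ 2 - p%:R * a + q%:R) * (a * dot (fun=> 1)))%R by ring.
    rewrite -E1.
    have -> : ((a ^+ 2 - p%:R * a + q%:R) * (2 * dot d) =
       2 * (a * (a * dot d) - p%:R * (a * dot d) + q%:R * dot d))%R by ring.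
    rewrite E3; have -> : (dot e = p%:R * dot d - a * dot d)%R by rewrite -E2; ring.
    by ring.
  by move/eqP; rewrite factor !mulf_eq0 (negPf one_neq0) orbF !subr_eq0 !inE.
rewrite !inE => /orP[/eqP-> | a_root]; apply/QmainP.
  (* The signs of the bipartition, for the eigenvalue 0. *)
  exists (fun x => (-1) ^+ side x)%R.
    move=> x; rewrite mul0r /lapl (eq_bigr (fun=> - (-1) ^+ side x)%R).
      rewrite sumr_const -cardsE -/(degree x).
      by rewrite mulNrn -[X in (_ - X)%R]mulr_natl; ring.
    by move=> y /bip ->; case: (side x); rewrite ?expr0 ?expr1 ?opprK.
  have -> : (\sum_x (-1) ^+ side x =
      #|G|%:R - ((\sum_(x : G) side x).*2)%:R :> R)%R.
    rewrite -muln2 mulnC natrM natr_sum mulr_sumr -sumr_const -sumrB.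
    by apply: eq_bigr => x _; case: (side x) => /=; ring.
  by rewrite subr_eq0 eqr_nat eq_sym.
have a_eq : (a ^+ 2 = p%:R * a - q%:R)%R.
  by apply/eqP; rewrite -subr_eq0 opprB addrCA addrC factor mulf_eq0 !subr_eq0.
exists (fun x => a * d x - e x)%R.
  move=> x.
  have -> : (lapl (fun x => a * d x - e x) x = a * lapl d x - lapl e x)%R.
    by rewrite /lapl sumrB -mulr_sumr; ring.
  rewrite lapld laple.
  have -> : (a * (a * d x - e x) = a ^+ 2 * d x - a * e x)%R by ring.
  by rewrite a_eq; ring.
rewrite sumrB -mulr_sumr -!natr_sum -/N -/C subr_eq0.
apply: contra nondeg => /eqP aN; rewrite -(eqr_nat R) (natrD _ (C ^ 2)) !(natrX, natrM).
rewrite -aN; apply/eqP.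
have -> : ((a * N%:R) ^+ 2 + q%:R * N%:R ^+ 2 =
  (a ^+ 2 + q%:R) * N%:R ^+ 2 :> R)%R by ring.
by rewrite a_eq; ring.
Qed.

(** * Checking a concrete graph by computation *)

Lemma mem_zip_behead (w : seq nat) (i j : nat) :
  (i, j) \in zip w (behead w) ->
  exists2 k, k.+1 < size w & (i, j) = (nth 0 w k, nth 0 w k.+1).
Proof.
have sz : size (zip w (behead w)) = (size w).-1.
  by rewrite size_zip size_behead; apply/minn_idPr/leq_pred.
case/(nthP (0, 0)) => k; rewrite sz => k_lt E; exists k; first by lia.
by rewrite -E nth_zip_cond sz k_lt nth_behead.
Qed.

Section Walks.
Variables (n : nat) (ws : seq (seq nat)).
Local Notation G := (walks_graph n ws).

(** The adjacency of [walks_graph] on plain numbers: it reduces without going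
    through ordinals, so that properties of a given graph can be evaluated. *)
Definition walks_rel (i j : nat) : bool :=
  (i != j) && has (fun w => let s := zip w (behead w) in
                            ((i, j) \in s) || ((j, i) \in s)) ws.

Definition walks_deg (i : nat) : nat := count (walks_rel i) (iota 0 n).

Lemma sum_walks (P : pred nat) (F : nat -> nat) :
  \sum_(x < n | P x) F x = sumn [seq F i | i <- iota 0 n & P i].
Proof.
by rewrite sumnE big_map big_filter -[in RHS](subn0 n) -/(index_iota 0 n) big_mkord.
Qed.

Lemma walks_degree (x : G) : degree x = walks_deg (val x).
Proof.
rewrite /degree cardsE -sum1_card /walks_deg -sum1_count.
have := sum_walks (walks_rel (val x)) (fun=> 1).
by rewrite sumnE big_map big_filter.
Qed.

(** Every vertex but 0 has a smaller neighbour, hence descends to 0. *)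
Lemma walks_connected :
  1 < n -> all (fun i => has (walks_rel i) (iota 0 i)) (iota 1 n.-1) ->
  conn_graph G.
Proof.
move=> n_gt1 /allP down.
have n_gt0 : 0 < n by apply: ltnW.
have step (x : G) : 0 < val x -> exists2 y : G, adj x y & val y < val x.
  move=> x_gt0; have x_lt := ltn_ord x.
  have /hasP[j] : has (walks_rel (val x)) (iota 0 (val x)).
    by apply: down; rewrite mem_iota x_gt0 /= add1n prednK.
  rewrite mem_iota add0n /= => j_lt xj.
  by exists (Ordinal (ltn_trans j_lt x_lt)).
have to0 (x : G) : connect (@adj G) x (Ordinal n_gt0).
  have [m] := ubnP (val x); elim: m x => // m IH x x_le.
  have [x0|x_gt0] := posnP (val x).
    by have -> : x = Ordinal n_gt0 by apply: val_inj.
  have [y xy y_lt] := step x x_gt0.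
  by apply: connect_trans (connect1 xy) (IH y _); apply: leq_trans y_lt _.
split=> [x y|].
  apply: connect_trans (to0 x) _.
  by rewrite (sym_connect_sym (@adj_sym G)).
have [y xy _] := step (Ordinal n_gt1) isT.
by exists (Ordinal n_gt1 : G), y.
Qed.

Lemma walks_three_Qmain (R : realType) (side : pred nat) (p : nat)
    (c : bool -> nat) (s := iota 0 n) (q := c true + c false)
    (N := sumn [seq walks_deg i | i <- s])
    (C := sumn [seq c (side i) | i <- s]) :
  all (fun i => all (fun j => walks_rel i j ==> (side j == ~~ side i)) s) s ->
  (count side s).*2 != n ->
  all (fun i => sumn [seq walks_deg j | j <- s & walks_rel i j]
                + walks_deg i ^ 2 + c (side i) == p * walks_deg i) s ->
  [&& 0 < q, 4 * q < p ^ 2 & C ^ 2 + q * N ^ 2 != p * C * N] ->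
  three_Qmain_with_zero R G.
Proof.
have mem_s (x : G) : val x \in s by rewrite mem_iota /= add0n.
move=> /allP bip unbal /allP loc /and3P[q_gt0 disc_gt0 nondeg].
have sumT F : \sum_(x : G) F (val x) = sumn [seq F i | i <- s].
  by rewrite (sum_walks xpredT) filter_predT.
apply: (@three_Qmain_criterion R G (fun x => side (val x)) p c) => //.
- move=> x y xy; apply/eqP.
  by have /allP/(_ _ (mem_s y))/implyP := bip _ (mem_s x); apply.
- by rewrite (sumT (fun i => side i : nat)) sumn_count card_ord.
- move=> x; rewrite walks_degree; have /eqP <- := loc _ (mem_s x).
  congr (_ + _ + _); under eq_bigr do rewrite walks_degree.
  exact: (sum_walks (walks_rel (val x))).
- have -> : \sum_(x : G) degree x = N.
    by rewrite /N -(sumT (walks_deg)); apply: eq_bigr => x _; apply: walks_degree.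
  by rewrite (sumT (fun i => c (side i))).
Qed.
End Walks.

(** Both sides count the pairs of an edge and one of its ends. *)
Lemma handshake (G : sgraph) : #|edges G|.*2 = \sum_(x : G) degree x.
Proof.
have edge_card E : E \in edges G -> #|E| = 2.
  rewrite inE => /existsP[x /existsP[y /andP[xy /eqP->]]].
  by rewrite cards2; case: eqP xy => // ->; rewrite adj_irr.
have incident x : degree x = #|[set E in edges G | x \in E]|.
  have <- : [set [set x; y] | y in [set y | adj x y]] =
            [set E in edges G | x \in E].
    apply/setP => E; rewrite !inE; apply/imsetP/andP.
      case=> y; rewrite inE => xy ->; rewrite !inE eqxx; split=> //.
      by apply/existsP; exists x; apply/existsP; exists y; rewrite xy eqxx.
    case=> /existsP[y /existsP[z /andP[yz /eqP->]]].
    rewrite !inE => /orP[] /eqP->; [exists z | exists y]; rewrite ?inE //.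
      by rewrite adj_sym.
    by rewrite setUC.
  rewrite card_in_imset // => y z; rewrite !inE => xy xz eq_yz.
  have : y \in [set x; z] by rewrite -eq_yz !inE eqxx orbT.
  by rewrite !inE => /orP[] /eqP // yx; rewrite yx adj_irr in xy.
rewrite -muln2 -sum_nat_const -(eq_bigr _ edge_card).
under [RHS]eq_bigr do rewrite incident -sum1_card.
under eq_bigr do rewrite -sum1_card.
rewrite (exchange_big_dep xpredT) //=; apply: eq_bigr => x _.
by apply: eq_bigl => E; rewrite !inE.
Qed.

Lemma walks_cyclomatic n ws k :
  sumn [seq walks_deg n ws i | i <- iota 0 n] + 2 = (n + k).*2 ->
  cyclomatic (walks_graph n ws) = k%:Z%R.
Proof.
move=> E; rewrite /cyclomatic card_ord.
have := handshake (walks_graph n ws).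
under eq_bigr do rewrite walks_degree.
rewrite (sum_walks n xpredT (walks_deg n ws)) filter_predT.
lia.
Qed.

(** * Invariants that separate the examples from the listed graphs *)

Lemma isomorphic_card (G H : sgraph) : isomorphic G H -> #|G| = #|H|.
Proof. by case=> f f_bij _; apply: bij_eq_card f_bij. Qed.

Lemma isomorphic_degree (G H : sgraph) (f : G -> H) :
  bijective f -> (forall x y, adj (f x) (f y) = adj x y) ->
  forall x, degree (f x) = degree x.
Proof.
move=> f_bij f_adj x; rewrite /degree -(card_imset _ (bij_inj f_bij)).
apply: eq_card => y; have [g fK gK] := f_bij.
rewrite -(gK y) (mem_imset _ _ (bij_inj f_bij)) !inE; exact: f_adj.
Qed.

Lemma card_attach_leaves (G : sgraph) (m : G -> nat) :
  #|attach_leaves m| = #|G| + \sum_x m x.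
Proof.
rewrite card_sum; congr (_ + _); rewrite card_tagged sumnE big_map big_enum /=.
by apply: eq_bigr => x _; rewrite card_ord.
Qed.

Lemma degree_leaf (G : sgraph) (m : G -> nat) (l : leaf m) :
  degree (inr l : attach_leaves m) = 1.
Proof.
rewrite /degree -(cards1 (inl (tag l) : attach_leaves m)).
by apply: eq_card => -[y|l']; rewrite !inE.
Qed.

Lemma degree_leafless (G : sgraph) (m : G -> nat) (x : G) :
  m x = 0 -> degree (inl x : attach_leaves m) = degree x.
Proof.
move=> mx0; rewrite /degree -(card_imset _ (@inl_inj G (leaf m))).
apply: eq_card => -[y|[z i]]; rewrite inE /=.
  by rewrite (mem_imset _ _ (@inl_inj G (leaf m))) inE.
transitivity false; last by apply/esym/imsetP => -[].
by apply/eqP => xz; move: i; rewrite -xz mx0 => -[].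
Qed.

Lemma cycle_adj n (x y : 'I_n) :
  adj (x : cycle_graph n) y -> y = ordS x \/ x = ordS y.
Proof.
rewrite /= /walks_adj /= orbF => /andP[_ xy].
have succ (u v : 'I_n) : (val u, val v) \in
    zip (rcons (iota 0 n) 0) (behead (rcons (iota 0 n) 0)) -> v = ordS u.
  case/mem_zip_behead => k; rewrite size_rcons size_iota ltnS => k_lt.
  rewrite !nth_rcons size_iota k_lt nth_iota // => -[u_k v_k].
  apply: val_inj; rewrite /= v_k u_k add0n.
  case: (ltngtP k.+1 n) => [k1_lt | | <-]; last by rewrite modnn.
    by rewrite nth_iota // add0n modn_small.
  by rewrite ltnNge k_lt.
by case/orP: xy => /succ; [left | right].
Qed.

Lemma cycle_degree n (x : cycle_graph n) : degree x <= 2.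
Proof.
apply: (@leq_trans #|[set ordS (x : 'I_n); ord_pred (x : 'I_n)]|).
  apply/subset_leq_card/subsetP => y; rewrite !inE => /cycle_adj[->|->].
    by rewrite eqxx.
  by rewrite ordSK eqxx orbT.
by rewrite cards2; case: eqP.
Qed.

Lemma even_cycle_adj m (x y : 'I_(m.*2)) :
  adj (x : cycle_graph m.*2) y -> odd y = ~~ odd x.
Proof.
have odd_succ (u : 'I_(m.*2)) : odd (ordS u) = ~~ odd u.
  by rewrite /= odd_mod ?odd_double.
by case/cycle_adj => ->; rewrite odd_succ ?negbK.
Qed.

(** An edge to a leaf is clear.  An edge of the cycle joins vertices of opposite
    parities, so one of its ends carries no leaf and keeps the degree that it has
    in the cycle. *)
Lemma cycle_leaves_degree m k b (u v : cycle_leaves m.*2 k b) :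
  adj u v -> (degree u <= 2) || (degree v <= 2).
Proof.
case: u v => [x|l] [y|l'] xy; rewrite ?degree_leaf ?orbT //.
have := even_cycle_adj xy; case: (boolP (odd x == b)) => [/eqP -> y_odd | x_b _].
  by rewrite orbC degree_leafless ?cycle_degree //= y_odd; case: (b).
by rewrite degree_leafless ?cycle_degree //= (negPf x_b).
Qed.

(** * The three graphs *)

(** Every vertex other than 0 is numbered after one of its neighbours, as
    [walks_connected] requires; this also holds for the next two graphs. *)
Definition claw_leaves : sgraph :=
  walks_graph 10 [:: [:: 4; 1; 5]; [:: 6; 2; 7]; [:: 8; 3; 9];
                     [:: 1; 0; 2]; [:: 0; 3]].

Definition C4_claws : sgraph :=
  walks_graph 12 [:: [:: 0; 1; 2; 3; 0]; [:: 1; 4; 6]; [:: 7; 4; 8];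
                     [:: 3; 5; 9]; [:: 10; 5; 11]].

Definition K23_leaves : sgraph :=
  walks_graph 8 [:: [:: 0; 1; 2; 3; 0; 4; 2]; [:: 1; 5]; [:: 3; 6]; [:: 4; 7]].

Theorem mainTheorem4 (R : realType) :
  (exists G : sgraph,
     [/\ tree G,
         three_Qmain_with_zero R G,
         (forall k : nat, ~ isomorphic G (path_leaves 5 k)) &
         ~ isomorphic G (path_leaves 7 1)]) /\
  (exists G : sgraph,
     [/\ unicyclic G,
         three_Qmain_with_zero R G &
         forall (m k : nat) (b : bool),
           (2 <= m)%N -> (0 < k)%N -> ~ isomorphic G (cycle_leaves m.*2 k b)]) /\
  (exists G : sgraph,
     [/\ bicyclic G,
         three_Qmain_with_zero R G,
         ~ isomorphic G two_C4_sharing_vertex,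
         ~ isomorphic G two_C4_joined_by_path4 &
         ~ isomorphic G three_paths4]).
Proof.
split; last split.
- exists claw_leaves; split.
  + by split; [apply: walks_connected | apply: (@walks_cyclomatic _ _ 0)].
  + apply: (@walks_three_Qmain _ _ R [pred i | i \in [:: 1; 2; 3]] 7
             (fun b => if b then 7 else 3)); by vm_compute.
  + move=> k /isomorphic_card; rewrite card_attach_leaves !card_ord.
    by rewrite !big_ord_recr big_ord0 /=; lia.
  + move/isomorphic_card; rewrite card_attach_leaves !card_ord.
    by rewrite !big_ord_recr big_ord0.
- exists C4_claws; split.
  + by split; [apply: walks_connected | apply: (@walks_cyclomatic _ _ 1)].
  + apply: (@walks_three_Qmain _ _ R [pred i | i \in [:: 0; 2; 4; 5]] 6
             (fun b => if b then 2 else 1)); by vm_compute.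
  + move=> m k b _ _ [f f_bij f_adj].
    (* Vertex 1 of the cycle has degree 3, the centre 4 of its claw degree 4. *)
    have x1 : 1 < 12 by []. have x4 : 4 < 12 by [].
    have := @cycle_leaves_degree m k b (f (Ordinal x1)) (f (Ordinal x4)).
    rewrite f_adj !(isomorphic_degree f_bij f_adj) !walks_degree.
    by vm_compute => /(_ isT).
- exists K23_leaves; split.
  + by split; [apply: walks_connected | apply: (@walks_cyclomatic _ _ 2)].
  + apply: (@walks_three_Qmain _ _ R [pred i | i \in [:: 1; 3; 4]] 7
             (fun b => if b then 5 else 3)); by vm_compute.
  + by move/isomorphic_card; rewrite !card_ord.
  + by move/isomorphic_card; rewrite !card_ord.
  + by move/isomorphic_card; rewrite !card_ord.
Qed.
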